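(* For $n\in\mathbb{N}_0$ and $t\ge0$ let $g_n(t):=\frac{t^n e^{-t}}{n!}$. The following hold. 1. (General estimate.) For all integers $n\ge0$, $m\ge0$, all $\ell\in\{0,1\}$ and all $t\ge0$, $$\left|t^{m+\ell}g_n^{(m)}(t)\right|\le C_m (n+1)^{\frac{m-1}{2}+\ell}\quad\text{with}\quad C_m:=(4e)^{m+3}(m+2)!.$$ 2. (Refined estimates for small and large arguments.) (a) (Small argument.) For all integers $n\ge 0$, $m\ge 0$ and all $t$ with $0\le t\le n-m\sqrt{n}$, $$\left|t^m g_n^{(m)}(t)\right|\le 2^{m+1}\frac{(m+2)!}{\sqrt{n+1}}\left(\frac{n}{n-t}\right)^m,$$ where the factor $\left(\frac{n}{n-t}\right)^m$ is defined to be $1$ when $m=0$ (in particular when $n=0$, in which case the condition on $t$ forces $t=m=0$). (b) (Large argument.) For all integers $n\ge0$, all integers $m\geq 0$ with $m\ge2\log(n+1)$, and all $\ell\in\{0,1\}$, with $c:=9/10$, $$\left|t^{m+\ell}g_n^{(m)}(t)\right|\le 4\left(\frac{3}{\ln\frac1c}\right)^m(m+2)!\,(n+1)^\ell\qquad\text{for all } t\ge\begin{cases}0 & \text{if } n=0,1,\\ n+m(\sqrt{n}+2) & \text{if } n\ge2.\end{cases}$$ 3. (Exponential decay.) For all integers $n\ge0$ and all $t\ge n+\sqrt{n}$, $$g_n(t)\le\frac{1}{\sqrt{n+1}}\exp\left(\sqrt{n}-\frac{t}{1+\sqrt{n}}\right).$$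
   Context: $g_n^{(m)}$ denotes the $m$-th derivative of $g_n$ with respect to $t$ (with $g_n^{(0)}=g_n$). $\log$ and $\ln$ both denote the natural logarithm. $\mathbb{N}_0=\{0,1,2,\dots\}$. *)

(* Defs.v *)
From Stdlib Require Import Reals Factorial.
From Coquelicot Require Import Coquelicot.
Open Scope R_scope.

(* Defined by the same formula on all of R, so that at t = 0 the two-sided
   derivatives agree with the one-sided ones on [0, +oo). *)
Definition g (n : nat) (t : R) : R := t ^ n * exp (- t) / INR (fact n).

Definition C_ (m : nat) : R := (4 * exp 1) ^ (m + 3) * INR (fact (m + 2)).

Definition large_threshold (n m : nat) : R :=
  match n with
  | 0%nat | 1%nat => 0
  | _ => INR n + INR m * (sqrt (INR n) + 2)
  end.

(* Main.v *)
Require Import Defs.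
From Stdlib Require Import Reals Factorial Lra Lia.
From Coquelicot Require Import Coquelicot.
Open Scope R_scope.

(** The functions [f_m = t^m g_n^(m)(t)] satisfy the three-term recurrence
    [f_(m+1) = (n - t - m) f_m - t m f_(m-1)], obtained by differentiating
    [t g' = (n - t) g], and every estimate compares [f_m] with [f_0 = g_n(t)].

    For arbitrary [t] a majorant argument (replacing Cauchy's estimate for
    [s |-> g_n(t + t s)] on the circle of radius [rho]) gives
    [|f_m| rho^m <= m! exp (|n - t| rho) f_0] as soon as [n rho^2 + rho <= 1];
    with [rho] of order [1 / (1 + sqrt n)] the exponential is absorbed by the decay
    of [g_n] away from its peak.

    For [|n - t|] larger than about [m sqrt n] the recurrence has real
    characteristic roots, so the [f_m], up to the sign [(-1)^m] when [t > n], stay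
    nonnegative and [|f_m| <= (C |n - t|)^m f_0]; the decay of [g_n] then
    controls the powers of [|n - t|].

    The decay comes from [g_n(n) <= 1 / sqrt (n + 1)] together with Gaussian bounds
    around the peak and the concavity of [ln g_n]. *)

(** * Elementary exponential inequalities *)

Lemma exp_pow (x : R) (n : nat) : exp x ^ n = exp (INR n * x).
Proof.
  induction n as [|n IH].
  - now rewrite Rmult_0_l, exp_0.
  - rewrite S_INR; simpl; rewrite IH, <- exp_plus; f_equal; ring.
Qed.

Lemma exp_le (x y : R) : x <= y -> exp x <= exp y.
Proof.
  intros [H | ->]; [left; now apply exp_increasing | apply Rle_refl].
Qed.

Lemma nonincreasing_of_derivative (f df : R -> R) (a b : R) :
  a <= b ->
  (forall x, a <= x <= b -> is_derive f x (df x)) ->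
  (forall x, a <= x <= b -> df x <= 0) -> f b <= f a.
Proof.
  intros [Hab | ->] Hd Hn; [|apply Rle_refl].
  destruct (MVT_cor2 f df a b Hab) as [c [Hc Hac]].
  - intros c Hc; apply is_derive_Reals, Hd, Hc.
  - assert (df c <= 0) by (apply Hn; lra). nra.
Qed.

(** The series of [ln (1 - u)] truncated after second order, where all dropped terms are negative.
    The proof covers all [u >= 0] at once: [(1 - x) * exp (x + x ^ 2 / 2)] equals 1 at 0 and has
    derivative [- x ^ 2 * exp (x + x ^ 2 / 2)]. *)
Lemma one_minus_le_exp (u : R) :
  0 <= u -> 1 - u <= exp (- u - u ^ 2 / 2).
Proof.
  intros Hu.
  assert (H : (1 - u) * exp (u + u ^ 2 / 2)
              <= (1 - 0) * exp (0 + 0 ^ 2 / 2)).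
  { apply (nonincreasing_of_derivative
      (fun x => (1 - x) * exp (x + x ^ 2 / 2))
      (fun x => - x ^ 2 * exp (x + x ^ 2 / 2))); [exact Hu| |].
    - intros x _; auto_derive; [easy|]. simpl. unfold Rminus, Rdiv.
      match goal with |- context [exp ?z] => generalize (exp z) end.
      intro r. field.
    - intros x _. pose proof (exp_pos (x + x ^ 2 / 2)). nra. }
  replace (0 + 0 ^ 2 / 2) with 0 in H by field. rewrite exp_0 in H.
  replace (- u - u ^ 2 / 2) with (- (u + u ^ 2 / 2)) by ring.
  rewrite exp_Ropp. pose proof (exp_pos (u + u ^ 2 / 2)) as Hp.
  apply (Rmult_le_reg_r (exp (u + u ^ 2 / 2))); [exact Hp|].
  rewrite Rinv_l; lra.
Qed.

(* The exponent [u (2 + u) / (2 (1 + u))] is the trapezoid rule for [ln (1 + u)]. *)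
Lemma one_plus_le_exp (u : R) :
  0 <= u -> 1 + u <= exp (u - u ^ 2 / (2 * (1 + u))).
Proof.
  intros Hu.
  assert (H : (1 + u) * exp (- (u - u ^ 2 / (2 * (1 + u))))
              <= (1 + 0) * exp (- (0 - 0 ^ 2 / (2 * (1 + 0))))).
  { apply (nonincreasing_of_derivative
      (fun x => (1 + x) * exp (- (x - x ^ 2 / (2 * (1 + x)))))
      (fun x => - (x ^ 2 / (2 * (1 + x)))
                * exp (- (x - x ^ 2 / (2 * (1 + x)))))); [exact Hu| |].
    - intros x [Hx _]; auto_derive; [lra|]. simpl. unfold Rminus, Rdiv.
      match goal with |- context [exp ?z] => generalize (exp z) end.
      intro r. field. lra.
    - intros x [Hx _].
      pose proof (exp_pos (- (x - x ^ 2 / (2 * (1 + x))))).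
      assert (0 <= x ^ 2 / (2 * (1 + x))) by (apply Rdiv_le_0_compat; nra).
      nra. }
  replace (- (0 - 0 ^ 2 / (2 * (1 + 0)))) with 0 in H by field.
  rewrite exp_0, exp_Ropp in H.
  set (v := u - u ^ 2 / (2 * (1 + u))) in *.
  pose proof (exp_pos v) as Hp.
  apply (Rmult_le_reg_r (/ exp v)); [now apply Rinv_0_lt_compat|].
  rewrite (Rinv_r (exp v)); lra.
Qed.

(** A single term of the exponential series; this is how exponential decay absorbs powers, at the
    price of a factorial. *)
Lemma pow_le_fact_exp (x : R) (m : nat) :
  0 <= x -> x ^ m <= INR (fact m) * exp x.
Proof.
  intros Hx. pose proof (exp_ge_taylor x m Hx) as H.
  assert (Hf := INR_fact_lt_0 m).
  assert (Hm : x ^ m / INR (fact m) <= exp x).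
  { eapply Rle_trans; [|exact H]. destruct m as [|m]; [apply Rle_refl|].
    rewrite tech5.
    assert (0 <= sum_f_R0 (fun k => x ^ k / INR (fact k)) m); [|lra].
    apply cond_pos_sum. intro k. apply Rdiv_le_0_compat.
    - now apply pow_le.
    - apply INR_fact_lt_0. }
  apply (Rmult_le_compat_l (INR (fact m))) in Hm; [|lra].
  replace (INR (fact m) * (x ^ m / INR (fact m))) with (x ^ m) in Hm;
    [exact Hm | field; lra].
Qed.

(** * Peak value and decay of [g n] *)

Lemma g_nonneg (n : nat) (t : R) : 0 <= t -> 0 <= g n t.
Proof.
  intros Ht. unfold g. apply Rdiv_le_0_compat; [|apply INR_fact_lt_0].
  apply Rmult_le_pos; [now apply pow_le | left; apply exp_pos].
Qed.

(** Since [g n t / g n s = (t / s) ^ n * exp (s - t)], any upper bound [a] on [ln (t / s)] compares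
    the two values. The next three lemmas differ mainly in the bound chosen for this logarithm. *)
Lemma g_le_of_ratio (n : nat) (s t a : R) :
  0 <= s -> 0 <= t -> t <= s * exp a ->
  g n t <= g n s * exp (INR n * a + s - t).
Proof.
  intros Hs Ht H. unfold g.
  assert (Hf := INR_fact_lt_0 n).
  replace (s ^ n * exp (- s) / INR (fact n) * exp (INR n * a + s - t))
    with ((s * exp a) ^ n * exp (- t) / INR (fact n)).
  - apply Rmult_le_compat_r; [left; now apply Rinv_0_lt_compat|].
    apply Rmult_le_compat_r; [left; apply exp_pos|].
    apply pow_incr; lra.
  - rewrite Rpow_mult_distr, exp_pow.
    replace (INR n * a + s - t) with (INR n * a + (s + - t)) by ring.
    rewrite !exp_plus, !exp_Ropp. field.
    pose proof (exp_pos s); pose proof (exp_pos t). lra.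
Qed.

(** Concavity of [ln (g n)], whose slope at [s] is [n / s - 1]; it amounts to
    [ln (t / s) <= t / s - 1]. *)
Lemma g_le_tangent (n : nat) (s t : R) :
  0 < s -> 0 <= t -> g n t <= g n s * exp ((INR n / s - 1) * (t - s)).
Proof.
  intros Hs Ht.
  replace ((INR n / s - 1) * (t - s)) with (INR n * (t / s - 1) + s - t)
    by (field; lra).
  apply g_le_of_ratio; try lra.
  pose proof (exp_ineq1_le (t / s - 1)) as H.
  apply (Rmult_le_compat_l s) in H; [|lra].
  replace (s * (1 + (t / s - 1))) with t in H by (field; lra). exact H.
Qed.

(** At the peak the first-order terms in [u = (n - t) / n] cancel, and [- n u ^ 2 / 2] remains. *)
Lemma g_le_peak_left (n : nat) (t : R) :
  (0 < n)%nat -> 0 <= t <= INR n ->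
  g n t <= g n (INR n) * exp (- ((INR n - t) ^ 2 / (2 * INR n))).
Proof.
  intros Hn Ht. apply lt_INR in Hn; simpl in Hn.
  pose proof (one_minus_le_exp ((INR n - t) / INR n)) as H.
  set (u := (INR n - t) / INR n) in *.
  replace (- ((INR n - t) ^ 2 / (2 * INR n)))
    with (INR n * (- u - u ^ 2 / 2) + INR n - t)
    by (unfold u; field; lra).
  apply g_le_of_ratio; try lra.
  replace t with (INR n * (1 - u)) by (unfold u; field; lra).
  apply Rmult_le_compat_l; [lra|]. apply H.
  unfold u; apply Rdiv_le_0_compat; lra.
Qed.

(** The denominator [2 t] covers two regimes: Gaussian decay while [t] is comparable to [n],
    exponential decay once [t - n] dominates. *)
Lemma g_le_peak_right (n : nat) (t : R) :
  0 < t -> INR n <= t ->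
  g n t <= g n (INR n) * exp (- ((t - INR n) ^ 2 / (2 * t))).
Proof.
  intros Ht Hnt. destruct n as [|n].
  (* For [n = 0] the relative deviation from the peak is undefined; the claim is then
     [exp (- t) <= exp (- (t / 2))]. *)
  - unfold g; simpl. rewrite Ropp_0, exp_0.
    replace (1 * exp (- t) / 1) with (exp (- t)) by field.
    replace (1 * 1 / 1) with 1 by field. rewrite Rmult_1_l.
    apply exp_le.
    replace ((t - 0) * ((t - 0) * 1) / (2 * t)) with (t / 2) by (field; lra).
    lra.
  - assert (Hn : 0 < INR (S n)) by (apply lt_0_INR; lia).
    pose proof (one_plus_le_exp ((t - INR (S n)) / INR (S n))) as H.
    set (u := (t - INR (S n)) / INR (S n)) in *.
    assert (Hu : 0 <= u) by (unfold u; apply Rdiv_le_0_compat; lra).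
    replace (- ((t - INR (S n)) ^ 2 / (2 * t)))
      with (INR (S n) * (u - u ^ 2 / (2 * (1 + u))) + INR (S n) - t)
      by (unfold u; field; lra).
    apply g_le_of_ratio; try lra.
    replace t with (INR (S n) * (1 + u)) by (unfold u; field; lra).
    apply Rmult_le_compat_l; [lra|]. now apply H.
Qed.

(* Induction on [n] through [g (n+1) (n+1) = g n (n+1)]. *)
Lemma g_peak_le (n : nat) : g n (INR n) <= / sqrt (INR n + 1).
Proof.
  induction n as [|n IH].
  - unfold g; simpl. rewrite Rplus_0_l, sqrt_1, Ropp_0, exp_0. lra.
  - assert (E : g (S n) (INR (S n)) = g n (INR n + 1)).
    { unfold g. rewrite S_INR, fact_simpl, mult_INR, S_INR. simpl. field.
      split; [apply INR_fact_neq_0|]. pose proof (pos_INR n). lra. }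
    rewrite E, S_INR. clear E.
    set (a := INR n + 1). pose proof (pos_INR n) as Hn.
    assert (Ha : 1 <= a) by (unfold a; lra).
    assert (H : g n a <= g n (INR n) * exp (- (1 / (2 * a)))).
    { replace (1 / (2 * a)) with ((a - INR n) ^ 2 / (2 * a))
        by (unfold a; field; lra).
      apply g_le_peak_right; unfold a; lra. }
    (* The decay over the unit interval from [n] to [n + 1] pays for passing from [1 / sqrt a] to
       [1 / sqrt (a + 1)]: this is the square root of [1 + 1 / a <= exp (1 / a)]. *)
    assert (Hs : sqrt (a + 1) <= sqrt a * exp (1 / (2 * a))).
    { rewrite <- (sqrt_Rsqr (exp (1 / (2 * a)))) by (left; apply exp_pos).
      rewrite <- sqrt_mult_alt by lra. apply sqrt_le_1_alt.
      unfold Rsqr. rewrite <- exp_plus.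
      replace (1 / (2 * a) + 1 / (2 * a)) with (/ a) by (field; lra).
      pose proof (exp_ineq1_le (/ a)) as He.
      apply (Rmult_le_compat_l a) in He; [|lra].
      rewrite Rmult_plus_distr_l, Rinv_r in He; lra. }
    assert (Ps : 0 < sqrt a) by (apply sqrt_lt_R0; lra).
    assert (Ps1 : 0 < sqrt (a + 1)) by (apply sqrt_lt_R0; lra).
    eapply Rle_trans; [exact H|].
    eapply Rle_trans; [apply Rmult_le_compat_r; [left; apply exp_pos|exact IH]|].
    fold a. rewrite exp_Ropp, <- Rinv_mult.
    now apply Rinv_le_contravar.
Qed.

(* The tangent to [ln (g n)] at [n + sqrt n]. *)
Lemma g_le_exp_decay (n : nat) (t : R) :
  0 <= t ->
  g n t <= / sqrt (INR n + 1) * exp (sqrt (INR n) - t / (1 + sqrt (INR n))).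
Proof.
  intros Ht. destruct n as [|n].
  - unfold g; simpl. rewrite Rplus_0_l, sqrt_1, sqrt_0.
    right. replace (0 - t / (1 + 0)) with (- t) by field. field.
  - assert (Hn : 0 < INR (S n)) by (apply lt_0_INR; lia).
    set (N := INR (S n)) in *.
    assert (Hs : 0 < sqrt N) by now apply sqrt_lt_R0.
    assert (Hq : sqrt N * sqrt N = N) by (apply sqrt_sqrt; lra).
    set (s := N + sqrt N).
    assert (Hps : 0 < s) by (unfold s; lra).
    eapply Rle_trans; [apply (g_le_tangent (S n) s); lra|]. fold N.
    (* With [q = sqrt N] one has [s = q (q + 1)], so the slope is [- 1 / (1 + q)] and
       [s / (1 + q) = q]. *)
    replace ((N / s - 1) * (t - s)) with (sqrt N - t / (1 + sqrt N)).
    + apply Rmult_le_compat_r; [left; apply exp_pos|].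
      eapply Rle_trans; [|apply (g_peak_le (S n))]. fold N.
      eapply Rle_trans; [apply (g_le_peak_right (S n)); unfold s, N in *; lra|].
      fold N. rewrite <- (Rmult_1_r (g (S n) N)) at 2.
      apply Rmult_le_compat_l; [apply g_nonneg; lra|].
      rewrite <- exp_0. apply exp_le.
      assert (0 <= (s - N) ^ 2 / (2 * s)); [|lra].
      apply Rdiv_le_0_compat; [apply pow2_ge_0 | lra].
    + unfold s. set (q := sqrt N) in *. rewrite <- Hq. field. split; nra.
Qed.

(** * Iterated derivatives and their three-term recurrence *)

(** From [g_n' = g_(n-1) - g_n], with the convention [g_(-1) = 0], the m-th derivative is an m-fold
    backward difference in [n]. *)
Fixpoint dg (m n : nat) (t : R) : R :=
  match m with
  | 0%nat => g n t
  | S m' => match n with 0%nat => 0 | S n' => dg m' n' t end - dg m' n t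
  end.

Lemma is_derive_dg (m n : nat) (t : R) : is_derive (dg m n) t (dg (S m) n t).
Proof.
  revert n t. induction m as [|m IH]; intros n t.
  - destruct n as [|n]; simpl; unfold g.
    + auto_derive; [easy|]. simpl; field.
    + auto_derive; [easy|].
      change (fact n + n * fact n)%nat with (fact (S n)).
      change (match n with 0%nat => 1 | S _ => INR n + 1 end) with (INR (S n)).
      change (t ^ S n) with (t * t ^ n).
      rewrite fact_simpl, mult_INR, S_INR. field.
      split; [apply INR_fact_neq_0|]. pose proof (pos_INR n). lra.
  - change (is_derive
      (fun x => match n with 0%nat => 0 | S n' => dg m n' x end - dg m n x) t
      (match n with 0%nat => 0 | S n' => dg (S m) n' t end - dg (S m) n t)).
    apply (is_derive_minus (V := R_NormedModule)).
    + destruct n as [|n]; [apply (is_derive_const (V := R_NormedModule)) | apply IH].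
    + apply IH.
Qed.

Lemma Derive_n_g (n m : nat) (t : R) : Derive_n (g n) m t = dg m n t.
Proof.
  revert t. induction m as [|m IH]; intros t; [reflexivity|].
  simpl Derive_n. rewrite (Derive_ext _ (dg m n)) by exact IH.
  apply is_derive_unique, is_derive_dg.
Qed.

(* [m] derivatives of [t g' = (n - t) g]. *)
Lemma dg_ode (n m : nat) (t : R) :
  t * dg (S m) n t
  = (INR n - t - INR m) * dg m n t - INR m * dg (pred m) n t.
Proof.
  revert t. induction m as [|m IH]; intros t.
  - rewrite Rmult_0_l. destruct n as [|n].
    + simpl; unfold g; simpl. field.
    + simpl dg. unfold g. rewrite fact_simpl, mult_INR, S_INR.
      simpl. field.
      split; [apply INR_fact_neq_0|]. pose proof (pos_INR n). lra.
  (* By the induction hypothesis [r x = x * dg (S m) n x] for all [x]; equating the derivatives of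
     both sides at [t] gives the next order. *)
  - set (r := fun x => (INR n - x - INR m) * dg m n x - INR m * dg (pred m) n x).
    assert (HL : is_derive (fun x => x * dg (S m) n x) t
                   (1 * dg (S m) n t + t * dg (S (S m)) n t)).
    { apply (is_derive_mult (K := R_AbsRing) (fun x => x) (dg (S m) n)).
      - apply (is_derive_id (K := R_AbsRing)).
      - apply is_derive_dg.
      - intros; apply Rmult_comm. }
    assert (HP : is_derive (fun x => INR m * dg (pred m) n x) t
                   (INR m * dg m n t)).
    { destruct m as [|m].
      - apply (is_derive_ext (fun _ => 0)); [intro; simpl; ring|].
        replace (INR 0 * dg 0 n t) with 0 by (simpl; ring).
        apply (is_derive_const (V := R_NormedModule)).
      - apply (is_derive_scal (dg m n)). apply is_derive_dg. }
    assert (HR : is_derive r t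
                   ((-1 * dg m n t + (INR n - t - INR m) * dg (S m) n t)
                    - INR m * dg m n t)).
    { apply (is_derive_minus (V := R_NormedModule)); [|exact HP].
      apply (is_derive_mult (K := R_AbsRing) (fun x => INR n - x - INR m) (dg m n)).
      - auto_derive; [easy|ring].
      - apply is_derive_dg.
      - intros; apply Rmult_comm. }
    apply (is_derive_ext _ r) in HL; [|intro x; apply IH].
    apply is_derive_unique in HL. apply is_derive_unique in HR.
    rewrite HL in HR. rewrite S_INR. simpl pred. lra.
Qed.

(** Stated for an arbitrary sequence and real [a], so that growth bounds become pure algebra. At
    [k = 0] the junk value [pred 0 = 0] is multiplied by [INR 0 = 0]. *)
Definition scaled_recurrence (a t : R) (f : nat -> R) : Prop :=
  forall k, f (S k) = (a - t - INR k) * f k - t * INR k * f (pred k).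

Lemma scaled_recurrence_g (n : nat) (t : R) :
  scaled_recurrence (INR n) t (fun m => t ^ m * Derive_n (g n) m t).
Proof.
  intros k. cbv beta. rewrite !Derive_n_g.
  replace (t ^ S k * dg (S k) n t) with (t ^ k * (t * dg (S k) n t))
    by (simpl; ring).
  rewrite dg_ode. destruct k as [|k]; simpl pred; simpl pow.
  - simpl INR. ring.
  - ring.
Qed.

(** * Majorant bound for arbitrary [t] *)

Definition exp_sum (x : R) (m : nat) : R :=
  sum_f_R0 (fun k => x ^ k / INR (fact k)) m.

Lemma exp_sum_pos (x : R) (m : nat) : 0 <= x -> 0 < exp_sum x m.
Proof.
  intros Hx. induction m as [|m IH].
  - unfold exp_sum; simpl. lra.
  - unfold exp_sum in *; rewrite tech5.
    assert (0 <= x ^ S m / INR (fact (S m))); [|lra].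
    apply Rdiv_le_0_compat; [now apply pow_le | apply INR_fact_lt_0].
Qed.

Lemma exp_sum_le_S (x : R) (m : nat) :
  0 <= x -> exp_sum x m <= exp_sum x (S m).
Proof.
  intros Hx. unfold exp_sum; rewrite tech5.
  assert (0 <= x ^ S m / INR (fact (S m))); [|lra].
  apply Rdiv_le_0_compat; [now apply pow_le | apply INR_fact_lt_0].
Qed.

(** Each step of the recurrence costs a factor [x + 1], while the factorial supplies [m + 1].
    Truncated sums make up the difference; with [exp x] on both sides the inequality would fail for
    [x > m]. *)
Lemma exp_sum_step (x : R) (m : nat) :
  0 <= x -> (x + 1) * exp_sum x m <= INR (S m) * exp_sum x (S m).
Proof.
  intros Hx. induction m as [|m IH].
  - unfold exp_sum; simpl. lra.
  - pose proof (exp_sum_pos x m Hx) as Hp.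
    assert (E1 : exp_sum x (S m) = exp_sum x m + x ^ S m / INR (fact (S m)))
      by reflexivity.
    assert (E2 : INR (S (S m)) * exp_sum x (S (S m))
                 = INR (S (S m)) * exp_sum x (S m)
                   + x * (x ^ S m / INR (fact (S m)))).
    { unfold exp_sum. rewrite (tech5 _ (S m)), Rmult_plus_distr_l. f_equal.
      rewrite (fact_simpl (S m)), mult_INR.
      change (x ^ S (S m)) with (x * x ^ S m). field.
      split; [apply INR_fact_neq_0 | apply not_0_INR; lia]. }
    rewrite E2. rewrite (S_INR (S m)).
    set (e := x ^ S m / INR (fact (S m))) in *.
    rewrite E1 in *. nra.
Qed.

(* With [U k = k f_k + t k f_(k-1)] one has [f_(k+1) = (a - t) f_k - U k] and
   [U (k+1) = (k+1) (a f_k - U k)]: the coefficient [t] occurs only through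
   [a - t], so that no cancellation is lost. *)
Lemma scaled_recurrence_le_exp (a t rho : R) (f : nat -> R) (m : nat) :
  0 <= a -> 0 < rho -> a * rho ^ 2 + rho <= 1 ->
  scaled_recurrence a t f ->
  Rabs (f m) * rho ^ m
    <= INR (fact m) * exp (Rabs (a - t) * rho) * Rabs (f 0%nat).
Proof.
  intros Ha Hr Har Hf. set (x := Rabs (a - t) * rho).
  assert (Hx : 0 <= x) by (apply Rmult_le_pos; [apply Rabs_pos | lra]).
  set (U := fun k => INR k * f k + t * INR k * f (pred k)).
  pose proof (Rabs_pos (f 0%nat)) as HG. set (G := Rabs (f 0%nat)) in *.
  (* [f m] and [U m] share one majorant, with one more power of [rho] on [U m]. *)
  assert (H : Rabs (f m) * rho ^ m <= INR (fact m) * (exp_sum x m * G)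
              /\ Rabs (U m) * rho ^ S m <= INR (fact m) * (exp_sum x m * G)).
  { induction m as [|m [IH1 IH2]].
    - unfold U, exp_sum; simpl. fold G.
      replace (0 * f 0%nat + t * 0 * f 0%nat) with 0 by ring.
      rewrite Rabs_R0. lra.
    - assert (E1 : f (S m) = (a - t) * f m - U m).
      { rewrite Hf. unfold U. ring. }
      assert (E2 : U (S m) = INR (S m) * (a * f m - U m)).
      { unfold U at 1. simpl pred. rewrite E1. ring. }
      pose proof (pos_INR (S m)) as Hm.
      pose proof (pow_lt rho m Hr) as Hrm.
      assert (B1 : Rabs (f (S m)) <= Rabs (a - t) * Rabs (f m) + Rabs (U m)).
      { rewrite E1, <- Rabs_mult, <- (Rabs_Ropp (U m)).
        apply Rabs_triang. }
      assert (B2 : Rabs (U (S m)) <= INR (S m) * (a * Rabs (f m) + Rabs (U m))).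
      { rewrite E2, Rabs_mult, (Rabs_pos_eq (INR (S m))) by exact Hm.
        apply Rmult_le_compat_l; [exact Hm|].
        rewrite <- (Rabs_pos_eq a) at 2 by exact Ha.
        rewrite <- Rabs_mult, <- (Rabs_Ropp (U m)). apply Rabs_triang. }
      pose proof (INR_fact_lt_0 m) as Hfm.
      pose proof (exp_sum_pos x m Hx) as HE.
      pose proof (exp_sum_le_S x m Hx) as HES.
      pose proof (exp_sum_step x m Hx) as HEX.
      rewrite fact_simpl, mult_INR.
      set (E := exp_sum x m) in *. set (E' := exp_sum x (S m)) in *.
      set (F := INR (fact m)) in *. set (s := INR (S m)) in *.
      set (u := Rabs (U m)) in *. set (v := Rabs (f m)) in *.
      assert (HFG : 0 <= F * G) by (apply Rmult_le_pos; lra).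
      change (rho ^ S (S m)) with (rho * (rho * rho ^ m)).
      change (rho ^ S m) with (rho * rho ^ m) in *.
      set (p := rho ^ m) in *.
      split.
      + apply Rle_trans with (x * (v * p) + u * (rho * p)).
        * unfold x. apply (Rmult_le_compat_r (rho * p)) in B1; nra.
        * apply Rle_trans with (F * G * ((x + 1) * E)).
          -- apply (Rmult_le_compat_l x) in IH1; nra.
          -- replace (s * F * (E' * G)) with (F * G * (s * E')) by ring.
             now apply Rmult_le_compat_l.
      + apply Rle_trans with (s * (a * rho ^ 2 * (v * p) + rho * (u * (rho * p)))).
        * apply (Rmult_le_compat_r (rho * (rho * p))) in B2; [|nra].
          eapply Rle_trans; [exact B2|right; ring].
        * replace (s * F * (E' * G)) with (s * (F * G * E')) by ring.
          apply Rmult_le_compat_l; [exact Hm|].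
          (* The condition [a * rho ^ 2 + rho <= 1] is what keeps [U] below the same majorant. *)
          apply Rle_trans with ((a * rho ^ 2 + rho) * (F * (E * G))).
          -- apply (Rmult_le_compat_l (a * rho ^ 2)) in IH1; [|nra].
             apply (Rmult_le_compat_l rho) in IH2; lra.
          -- assert (0 <= F * G * E) by nra.
             apply Rle_trans with (F * G * E); [nra|].
             now apply Rmult_le_compat_l. }
  destruct H as [H _]. eapply Rle_trans; [exact H|].
  rewrite Rmult_assoc. apply Rmult_le_compat_l; [apply pos_INR|].
  apply Rmult_le_compat_r; [exact HG|]. now apply exp_ge_taylor.
Qed.

(** * The recurrence with real characteristic roots, far from the peak *)

(* The lower bound on the ratios keeps the sequence nonnegative; it holds as long
   as the discriminants [b_k ^ 2 - 4 c_k] stay nonnegative, up to the shift in [k]. *)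
Lemma positive_recurrence_le (b c h : nat -> R) (D : R) (m : nat) :
  0 <= h 0%nat -> c 0%nat = 0 ->
  (forall k, h (S k) = b k * h k - c k * h (pred k)) ->
  (forall k, (k < m)%nat -> 0 < b k <= D) ->
  (forall k, (k < m)%nat -> 0 <= c k) ->
  (forall k, (S k < m)%nat -> 4 * c (S k) <= b (S k) * b k) ->
  0 <= h m <= D ^ m * h 0%nat.
Proof.
  intros H0 Hc0 Hrec Hb Hc Hdisc.
  assert (Hr : forall k, (k < m)%nat -> 0 <= h k /\ b k / 2 * h k <= h (S k)).
  { induction k as [|k IH]; intros Hk.
    - rewrite Hrec, Hc0. specialize (Hb 0%nat Hk). split; nra.
    - destruct IH as [P1 P2]; [lia|].
      pose proof (Hb k ltac:(lia)) as Hbk. pose proof (Hb (S k) Hk) as HbS.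
      pose proof (Hc (S k) Hk) as HcS. pose proof (Hdisc k Hk) as Hd.
      assert (0 <= h (S k)) by nra. split; [assumption|].
      rewrite (Hrec (S k)). simpl pred.
      assert (c (S k) * h k <= b (S k) / 2 * h (S k)); [|lra].
      apply Rle_trans with (b (S k) / 2 * (b k / 2 * h k)); [nra|].
      apply Rmult_le_compat_l; lra. }
  assert (Hu : forall k, (k <= m)%nat -> 0 <= h k <= D ^ k * h 0%nat).
  { induction k as [|k IH]; intros Hk; [simpl; lra|].
    destruct IH as [_ P]; [lia|].
    destruct (Hr k ltac:(lia)) as [Q1 Q2].
    pose proof (Hb k ltac:(lia)) as Hbk. pose proof (Hc k ltac:(lia)) as Hck.
    split; [nra|].
    apply Rle_trans with (b k * h k).
    - rewrite Hrec. destruct k as [|k].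
      + rewrite Hc0; lra.
      + simpl pred. assert (0 <= h k) by (apply Hr; lia). nra.
    - simpl pow. rewrite Rmult_assoc. apply Rmult_le_compat; lra. }
  apply Hu, le_n.
Qed.

Lemma scaled_recurrence_left (a t : R) (f : nat -> R) (m : nat) :
  0 <= t -> 0 <= f 0%nat -> 1 <= a -> t <= a - INR m * sqrt a ->
  scaled_recurrence a t f ->
  0 <= f m <= (a - t) ^ m * f 0%nat.
Proof.
  intros Ht H0 Ha Hta Hf.
  assert (Hs : sqrt a * sqrt a = a) by (apply sqrt_sqrt; lra).
  assert (Hs1 : 1 <= sqrt a) by (rewrite <- sqrt_1; now apply sqrt_le_1_alt).
  set (d := a - t).
  apply (positive_recurrence_le (fun k => d - INR k) (fun k => t * INR k) f).
  - exact H0.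
  - simpl; ring.
  - intro k; rewrite Hf; unfold d; reflexivity.
  - intros k Hk. pose proof (pos_INR k).
    apply lt_INR in Hk. unfold d. split; nra.
  - intros k _. apply Rmult_le_pos; [exact Ht | apply pos_INR].
  - intros k Hk. pose proof (pos_INR k) as Pk.
    apply le_INR in Hk. rewrite !S_INR in *.
    set (j := INR k) in *. set (M := INR m) in *.
    assert (Hd : M * sqrt a <= d) by (unfold d; lra).
    assert (Hdj : j + 1 <= d) by nra.
    (* Substituting [t = a - d] and completing the square reduces the discriminant condition to
       this. It follows from [d >= M * sqrt a] and [4 (j + 1) <= 4 (M - 1) <= M ^ 2]. *)
    assert (HD : 4 * a * (j + 1) <= (d + (j + 1)) ^ 2).
    { apply Rle_trans with (d ^ 2); [|nra].
      apply Rle_trans with ((M * sqrt a) ^ 2);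
        [|apply pow_incr; split; [apply Rmult_le_pos; lra | exact Hd]].
      replace ((M * sqrt a) ^ 2) with (M ^ 2 * a) by (rewrite <- Hs at 1; ring).
      pose proof (pow2_ge_0 (M - 2)).
      assert (4 * (j + 1) <= M ^ 2) by lra. nra. }
    assert (E : t = a - d) by (unfold d; ring). rewrite E. nra.
Qed.

Lemma scaled_recurrence_right (a t : R) (f : nat -> R) (m : nat) :
  0 <= f 0%nat -> 1 <= a -> a + INR m * (sqrt a + 2) <= t ->
  scaled_recurrence a t f ->
  Rabs (f m) <= (2 * (t - a)) ^ m * f 0%nat.
Proof.
  intros H0 Ha Hta Hf.
  assert (Hs : sqrt a * sqrt a = a) by (apply sqrt_sqrt; lra).
  assert (Hs1 : 1 <= sqrt a) by (rewrite <- sqrt_1; now apply sqrt_le_1_alt).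
  set (y := t - a).
  pose proof (pos_INR m) as Pm.
  assert (Hy : INR m * (sqrt a + 2) <= y) by (unfold y; lra).
  (* To the right of the peak the terms alternate; the sign change turns the coefficient [a - t - k]
     into the positive [y + k], and [y + k <= 2 y] since [k < m <= y]. *)
  set (h := fun k => (-1) ^ k * f k).
  assert (Hh : 0 <= h m <= (2 * y) ^ m * h 0%nat).
  { apply (positive_recurrence_le (fun k => y + INR k) (fun k => t * INR k)).
    - unfold h; simpl; lra.
    - simpl; ring.
    - intro k. unfold h. rewrite Hf. unfold y. destruct k as [|k]; simpl; ring.
    - intros k Hk. pose proof (pos_INR k). apply lt_INR in Hk. split; nra.
    - intros k _. apply Rmult_le_pos; [nra | apply pos_INR].
    - intros k Hk. pose proof (pos_INR k) as Pk.
      apply le_INR in Hk. rewrite !S_INR in *.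
      set (j := INR k) in *. set (M := INR m) in *.
      assert (Ey : t = a + y) by (unfold y; ring). rewrite Ey.
      set (q := sqrt a) in *.
      (* Completing the square in the discriminant condition leaves [K]. The summand 2 in
         [sqrt a + 2] ensures [z >= M * (q + 1)], enough to absorb the linear terms
         [z + 2 * (j + 1)]. *)
      set (z := y - (j + 1)).
      assert (Hz : M * q + M <= z) by (unfold z; nra).
      assert (HM : 2 <= M) by lra.
      assert (Hz1 : (M * q + M) * (M * q + M - 1) <= z * (z - 1)).
      { apply Rmult_le_compat; nra. }
      assert (K : z + 2 * (j + 1) + 4 * a * (j + 1) <= z ^ 2).
      { assert (4 * a * (j + 1) <= 4 * a * (M - 1)) by nra.
        assert (0 <= (M - 2) ^ 2 * a) by (apply Rmult_le_pos; [apply pow2_ge_0|lra]).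
        assert (0 <= M * q * (2 * M - 1)) by (apply Rmult_le_pos; nra).
        assert (M ^ 2 * a = (M * q) * (M * q)) by (rewrite <- Hs; ring).
        nra. }
      replace y with (z + (j + 1)) by (unfold z; ring). nra. }
  assert (E : Rabs (f m) = h m).
  { rewrite <- (Rabs_pos_eq (h m)) by apply Hh. unfold h.
    rewrite Rabs_mult, pow_1_abs. ring. }
  rewrite E. replace (f 0%nat) with (h 0%nat) by (unfold h; simpl; ring). apply Hh.
Qed.

(** * The general estimate *)

Lemma INR_fact_le (m n : nat) : (m <= n)%nat -> INR (fact m) <= INR (fact n).
Proof. intros H. now apply le_INR, fact_le. Qed.

(* For [t >= n] the factor [exp (|n - t| * rho)] uses up half of the decay rate
   [1 / (1 + sqrt n)]; the other half absorbs [t ^ l]. *)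
Lemma g_weighted_le (n l : nat) (t : R) :
  l = 0%nat \/ l = 1%nat -> 0 <= t ->
  t ^ l * (g n t * exp (Rabs (INR n - t) * / (2 * (1 + sqrt (INR n)))))
    <= 4 * (INR n + 1) ^ l * / sqrt (INR n + 1).
Proof.
  intros Hl Ht. pose proof (pos_INR n) as Hn. pose proof (sqrt_pos (INR n)) as Hq.
  assert (Hqq : sqrt (INR n) * sqrt (INR n) = INR n) by now apply sqrt_sqrt.
  set (N := INR n) in *. set (q := sqrt N) in *.
  set (rho := / (2 * (1 + q))).
  assert (Hr : 0 < rho) by (apply Rinv_0_lt_compat; lra).
  assert (HS : 0 < / sqrt (N + 1)) by (apply Rinv_0_lt_compat, sqrt_lt_R0; lra).
  set (S := / sqrt (N + 1)) in *.
  pose proof exp_le_3 as He.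
  pose proof (exp_pos 1) as He0.
  destruct (Rle_or_lt t N) as [HtN | HtN].
  - rewrite Rabs_pos_eq by lra.
    assert (H : g n t * exp ((N - t) * rho) <= 3 * S).
    { destruct n as [|n'].
      - assert (t = 0) by (unfold N in *; simpl in *; lra). subst t.
        unfold S, N, g; simpl.
        replace ((0 - 0) * rho) with 0 by ring.
        rewrite Ropp_0, exp_0, Rplus_0_l, sqrt_1. lra.
      - assert (HN : 0 < N) by (apply lt_0_INR; lia).
        assert (Hq0 : 0 < q) by now apply sqrt_lt_R0.
        pose proof (g_le_peak_left (Datatypes.S n') t ltac:(lia) (conj Ht HtN)) as H.
        pose proof (g_peak_le (Datatypes.S n')) as Hp. fold N S in H, Hp.
        set (e := exp (- ((N - t) ^ 2 / (2 * N)))) in *.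
        assert (H1 : g (Datatypes.S n') t <= S * e).
        { eapply Rle_trans; [exact H|].
          apply Rmult_le_compat_r; [left; apply exp_pos | exact Hp]. }
        apply Rle_trans with (S * e * exp ((N - t) * rho)).
        { apply Rmult_le_compat_r; [left; apply exp_pos | exact H1]. }
        rewrite Rmult_assoc, (Rmult_comm 3).
        apply Rmult_le_compat_l; [lra|].
        unfold e. rewrite <- exp_plus.
        eapply Rle_trans; [|exact He]. apply exp_le.
        (* In this variable the Gaussian exponent is [- v ^ 2 / 2] and the growth exponent at most
           [v]; their sum stays below 1. *)
        set (v := (N - t) / q).
        replace ((N - t) ^ 2 / (2 * N)) with (v ^ 2 / 2)
          by (unfold v; rewrite <- Hqq; field; lra).
        assert (Hv : 0 <= v) by (unfold v; apply Rdiv_le_0_compat; lra).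
        assert ((N - t) * rho <= v).
        { unfold v, rho, Rdiv. apply Rmult_le_compat_l; [lra|].
          apply Rinv_le_contravar; lra. }
        pose proof (pow2_ge_0 (v - 1)). lra. }
    apply Rle_trans with ((N + 1) ^ l * (3 * S)).
    + apply Rmult_le_compat; [now apply pow_le| |apply pow_incr; lra|exact H].
      apply Rmult_le_pos; [now apply g_nonneg | left; apply exp_pos].
    + assert (0 < (N + 1) ^ l) by (apply pow_lt; lra). nra.
  - rewrite Rabs_left by lra.
    set (y := t - N). assert (Hy : 0 < y) by (unfold y; lra).
    replace (- (N - t) * rho) with (y * rho) by (unfold y; ring).
    assert (H : g n t * exp (y * rho) <= S * exp (1 - y * rho)).
    { eapply Rle_trans;
        [apply Rmult_le_compat_r; [left; apply exp_pos | now apply g_le_exp_decay]|].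
      fold N q S. rewrite Rmult_assoc. apply Rmult_le_compat_l; [lra|].
      rewrite <- exp_plus. apply exp_le.
      replace (q - t / (1 + q) + y * rho) with (1 - / (1 + q) - y * rho).
      - assert (0 < / (1 + q)) by (apply Rinv_0_lt_compat; lra). lra.
      - replace t with (q * q + y) by (unfold y; lra). unfold rho. field. lra. }
    assert (He1 : exp (1 - y * rho) <= 3).
    { eapply Rle_trans; [|exact He]. apply exp_le. nra. }
    destruct Hl as [-> | ->].
    + simpl pow. nra.
    (* This is [z <= exp (z - 1)] at [z = y * rho], divided by [rho]. *)
    + assert (Hye : y * exp (1 - y * rho) <= 2 * (1 + q)).
      { pose proof (exp_ineq1_le (y * rho - 1)) as Hi.
        replace (1 - y * rho) with (- (y * rho - 1)) by ring.
        rewrite exp_Ropp.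
        pose proof (exp_pos (y * rho - 1)) as Hp.
        apply (Rmult_le_reg_r (exp (y * rho - 1))); [exact Hp|].
        rewrite Rmult_assoc, Rinv_l by lra.
        apply (Rmult_le_compat_l (2 * (1 + q))) in Hi; [|lra].
        replace (2 * (1 + q) * (1 + (y * rho - 1))) with y in Hi
          by (unfold rho; field; lra).
        lra. }
      rewrite !pow_1.
      apply Rle_trans with (t * (S * exp (1 - y * rho))).
      { now apply Rmult_le_compat_l. }
      replace (t * (S * exp (1 - y * rho)))
        with (S * (N * exp (1 - y * rho) + y * exp (1 - y * rho)))
        by (unfold y; ring).
      rewrite (Rmult_comm _ S). apply Rmult_le_compat_l; [lra|].
      (* The constant 4 comes from [3 N + 2 (1 + sqrt N) <= 4 (N + 1)]. *)
      pose proof (pow2_ge_0 (q - 1)). nra.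
Qed.

(** The majorant bound with [rho = 1 / (2 (1 + sqrt n))]: small enough for [n rho ^ 2 + rho <= 1]
    and for the decay of [g n] to absorb the exponential, yet [1 / rho <= 4 sqrt (n + 1)]. *)
Lemma scaled_derivative_le (n m l : nat) (t : R) :
  l = 0%nat \/ l = 1%nat -> 0 <= t ->
  Rabs (t ^ (m + l) * Derive_n (g n) m t)
    <= INR (fact m) * (4 * sqrt (INR n + 1)) ^ m
       * (4 * (INR n + 1) ^ l * / sqrt (INR n + 1)).
Proof.
  intros Hl Ht. pose proof (pos_INR n) as Hn. pose proof (sqrt_pos (INR n)) as Hq.
  assert (Hqq : sqrt (INR n) * sqrt (INR n) = INR n) by now apply sqrt_sqrt.
  pose proof (g_weighted_le n l t Hl Ht) as HW.
  set (rho := / (2 * (1 + sqrt (INR n)))) in *.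
  assert (Hr : 0 < rho) by (apply Rinv_0_lt_compat; lra).
  assert (Har : INR n * rho ^ 2 + rho <= 1).
  { set (q := sqrt (INR n)) in *. rewrite <- Hqq.
    replace (q * q * rho ^ 2 + rho)
      with ((q * q + 2 * (1 + q)) / (2 * (1 + q)) ^ 2)
      by (unfold rho; field; lra).
    apply (Rdiv_le_1 (q * q + 2 * (1 + q))); nra. }
  pose proof (scaled_recurrence_le_exp (INR n) t rho _ m Hn Hr Har
                (scaled_recurrence_g n t)) as H.
  cbv beta in H. simpl (t ^ 0) in H. rewrite Rmult_1_l in H.
  simpl (Derive_n (g n) 0 t) in H.
  rewrite (Rabs_pos_eq (g n t)) in H by now apply g_nonneg.
  set (F := t ^ m * Derive_n (g n) m t) in *.
  replace (t ^ (m + l) * Derive_n (g n) m t) with (t ^ l * F)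
    by (unfold F; rewrite pow_add; ring).
  rewrite Rabs_mult, (Rabs_pos_eq (t ^ l)) by now apply pow_le.
  set (B := 4 * (INR n + 1) ^ l * / sqrt (INR n + 1)) in *.
  pose proof (INR_fact_lt_0 m) as Hf.
  assert (HB : t ^ l * (Rabs F * rho ^ m) <= INR (fact m) * B).
  { apply (Rmult_le_compat_l (t ^ l)) in H; [|now apply pow_le].
    eapply Rle_trans; [exact H|].
    apply (Rmult_le_compat_l (INR (fact m))) in HW; [|lra].
    eapply Rle_trans; [|exact HW]. right; ring. }
  assert (Hrm : 0 < rho ^ m) by now apply pow_lt.
  assert (HB0 : 0 <= B).
  { eapply Rle_trans; [|exact HW]. apply Rmult_le_pos; [now apply pow_le|].
    apply Rmult_le_pos; [now apply g_nonneg | left; apply exp_pos]. }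
  assert (Hs : 1 <= 4 * sqrt (INR n + 1) * rho).
  { apply (Rmult_le_reg_r (2 * (1 + sqrt (INR n)))); [lra|].
    unfold rho. rewrite Rmult_assoc, Rinv_l by lra.
    assert (1 <= sqrt (INR n + 1))
      by (rewrite <- sqrt_1 at 1; apply sqrt_le_1_alt; lra).
    assert (sqrt (INR n) <= sqrt (INR n + 1)) by (apply sqrt_le_1_alt; lra).
    lra. }
  apply (pow_R1_Rle _ m) in Hs. rewrite Rpow_mult_distr in Hs.
  apply (Rmult_le_reg_r (rho ^ m)); [exact Hrm|].
  replace (t ^ l * Rabs F * rho ^ m) with (t ^ l * (Rabs F * rho ^ m)) by ring.
  eapply Rle_trans; [exact HB|].
  replace (INR (fact m) * (4 * sqrt (INR n + 1)) ^ m * B * rho ^ m)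
    with (INR (fact m) * B * ((4 * sqrt (INR n + 1)) ^ m * rho ^ m)) by ring.
  rewrite <- (Rmult_1_r (INR (fact m) * B)) at 1.
  apply Rmult_le_compat_l; [|exact Hs]. apply Rmult_le_pos; lra.
Qed.

Lemma Rpower_half_exponent (x : R) (m l : nat) :
  0 < x ->
  Rpower x ((INR m - 1) / 2 + INR l) = sqrt x ^ m * (x ^ l * / sqrt x).
Proof.
  intros Hx.
  replace ((INR m - 1) / 2 + INR l) with (/ 2 * INR m + (INR l + - / 2)) by field.
  rewrite !Rpower_plus, Rpower_Ropp, <- Rpower_mult, Rpower_sqrt by exact Hx.
  rewrite !Rpower_pow by (try apply sqrt_lt_R0; exact Hx). reflexivity.
Qed.

Lemma general_estimate (n m l : nat) (t : R) :
  l = 0%nat \/ l = 1%nat -> 0 <= t ->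
  Rabs (t ^ (m + l) * Derive_n (g n) m t)
    <= C_ m * Rpower (INR n + 1) ((INR m - 1) / 2 + INR l).
Proof.
  intros Hl Ht. pose proof (pos_INR n) as Hn.
  rewrite Rpower_half_exponent by lra.
  eapply Rle_trans; [now apply scaled_derivative_le|].
  rewrite Rpow_mult_distr.
  assert (HS : 0 < sqrt (INR n + 1)) by (apply sqrt_lt_R0; lra).
  set (X := sqrt (INR n + 1) ^ m * ((INR n + 1) ^ l * / sqrt (INR n + 1))).
  assert (HX : 0 <= X).
  { repeat apply Rmult_le_pos.
    - apply pow_le; lra.
    - apply pow_le; lra.
    - left; now apply Rinv_0_lt_compat. }
  replace (INR (fact m) * (4 ^ m * sqrt (INR n + 1) ^ m)
           * (4 * (INR n + 1) ^ l * / sqrt (INR n + 1)))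
    with (4 ^ (m + 1) * INR (fact m) * X)
    by (unfold X; rewrite pow_add; simpl; ring).
  apply Rmult_le_compat_r; [exact HX|]. unfold C_.
  pose proof (exp_ineq1_le 1) as He.
  apply Rmult_le_compat.
  - apply pow_le; lra.
  - apply pos_INR.
  - apply Rle_trans with (4 ^ (m + 3)); [apply Rle_pow; [lra|lia]|].
    apply pow_incr; lra.
  - apply INR_fact_le; lia.
Qed.

(** * Small arguments *)

(** The recurrence bounds the left side by [d ^ m * g n t] with [d = n - t]. Setting
    [X = d ^ 2 / (2 n)] gives [d = 2 (n / d) X], and the Gaussian factor [exp (- X)] absorbs
    [X ^ m]. *)
Lemma small_argument_estimate (n m : nat) (t : R) :
  0 <= t <= INR n - INR m * sqrt (INR n) ->
  Rabs (t ^ m * Derive_n (g n) m t)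
    <= 2 ^ (m + 1) * (INR (fact (m + 2)) / sqrt (INR n + 1))
       * (INR n / (INR n - t)) ^ m.
Proof.
  intros [Ht Htn].
  destruct n as [|n'].
  (* Here [t = 0], and the quotient [0 / 0] is 0 in Rocq: its power is 1 for [m = 0], and for
     [m > 0] both sides vanish. *)
  - simpl INR in *. rewrite sqrt_0 in Htn.
    assert (t = 0) by lra. subst t.
    replace (0 / (0 - 0)) with 0 by (unfold Rdiv; ring).
    destruct m as [|m].
    + simpl. unfold g; simpl. rewrite Ropp_0, exp_0, Rplus_0_l, sqrt_1.
      rewrite Rabs_pos_eq; lra.
    + rewrite pow_i by lia. rewrite Rmult_0_l, Rabs_R0. lra.
  - set (n := S n') in *.
    assert (HN : 1 <= INR n) by (apply (le_INR 1); unfold n; lia).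
    pose proof (scaled_recurrence_g n t) as Hrec.
    assert (HG := g_nonneg n t Ht).
    assert (HG0 : 0 <= t ^ 0 * Derive_n (g n) 0 t) by (simpl; lra).
    destruct (scaled_recurrence_left (INR n) t
                (fun k => t ^ k * Derive_n (g n) k t) m Ht HG0 HN Htn Hrec)
      as [P1 P2].
    cbv beta in P1, P2. simpl (t ^ 0) in P2.
    simpl (Derive_n (g n) 0 t) in P2. rewrite Rmult_1_l in P2.
    rewrite Rabs_pos_eq by exact P1. eapply Rle_trans; [exact P2|].
    assert (HmS : 0 <= INR m * sqrt (INR n))
      by (apply Rmult_le_pos; [apply pos_INR | apply sqrt_pos]).
    assert (HGle : g n t <= / sqrt (INR n + 1)
                            * exp (- ((INR n - t) ^ 2 / (2 * INR n)))).
    { eapply Rle_trans; [apply g_le_peak_left; [unfold n; lia | lra]|].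
      apply Rmult_le_compat_r; [left; apply exp_pos | apply g_peak_le]. }
    set (S := / sqrt (INR n + 1)) in *.
    assert (HS : 0 < S) by (apply Rinv_0_lt_compat, sqrt_lt_R0; lra).
    set (d := INR n - t) in *. assert (Hd : 0 <= d) by (unfold d; lra).
    set (X := d ^ 2 / (2 * INR n)) in *.
    assert (HX : 0 <= X) by (apply Rdiv_le_0_compat; [apply pow2_ge_0 | lra]).
    assert (HdX : d ^ m = 2 ^ m * (INR n / d) ^ m * X ^ m).
    (* Only for [m > 0] does the hypothesis force [d > 0] and allow division by [d]. *)
    { destruct m as [|m]; [simpl; ring|].
      rewrite <- !Rpow_mult_distr. f_equal. unfold X. field.
      assert (0 < sqrt (INR n)) by (apply sqrt_lt_R0; lra).
      assert (0 < INR (Datatypes.S m)) by (apply lt_0_INR; lia).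
      assert (0 < INR (Datatypes.S m) * sqrt (INR n)) by now apply Rmult_lt_0_compat.
      unfold d; lra. }
    assert (HD : 0 <= 2 ^ m * (INR n / d) ^ m).
    { rewrite <- Rpow_mult_distr. apply pow_le.
      destruct (Req_dec d 0) as [-> | Hd0].
      - unfold Rdiv. rewrite Rinv_0. lra.
      - apply Rmult_le_pos; [lra|]. apply Rdiv_le_0_compat; lra. }
    rewrite HdX.
    assert (HXe : X ^ m * exp (- X) <= INR (fact (m + 2))).
    { eapply Rle_trans with (INR (fact m)); [|apply INR_fact_le; lia].
      rewrite exp_Ropp. pose proof (exp_pos X).
      apply (Rmult_le_reg_r (exp X)); [easy|].
      rewrite Rmult_assoc, Rinv_l by lra. rewrite Rmult_1_r.
      now apply pow_le_fact_exp. }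
    apply Rle_trans with (2 ^ m * (INR n / d) ^ m * X ^ m * (S * exp (- X))).
    { apply Rmult_le_compat_l; [|exact HGle].
      apply Rmult_le_pos; [exact HD | now apply pow_le]. }
    rewrite pow_add, pow_1.
    unfold Rdiv at 2. fold S.
    set (D := 2 ^ m * (INR n / d) ^ m) in *.
    replace (D * X ^ m * (S * exp (- X))) with (D * S * (X ^ m * exp (- X))) by ring.
    replace (2 ^ m * 2 * (INR (fact (m + 2)) * S) * (INR n / d) ^ m)
      with (2 * (D * S * INR (fact (m + 2)))) by (unfold D; ring).
    assert (H0 : 0 <= D * S) by (apply Rmult_le_pos; lra).
    apply (Rmult_le_compat_l (D * S)) in HXe; [|exact H0].
    pose proof (pos_INR (fact (m + 2))).
    assert (0 <= D * S * INR (fact (m + 2))) by now apply Rmult_le_pos.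
    lra.
Qed.

(** * Large arguments *)

(* With [y = m sqrt n w], [w >= 1]: [n ^ (m / 2) <= exp (m ^ 2 / 4)] cancels the
   Gaussian factor at [w = 1]. *)
Lemma pow_gaussian_le (n m : nat) (y : R) :
  (1 <= n)%nat -> (2 <= m)%nat -> 2 * ln (INR n + 1) <= INR m ->
  INR m * sqrt (INR n) <= y ->
  y ^ m * exp (- (y ^ 2 / (4 * INR n))) <= 3 ^ m * INR (fact m).
Proof.
  intros Hn Hm Hln Hy.
  apply (le_INR 1) in Hn. simpl in Hn.
  assert (HM : 2 <= INR m) by now apply (le_INR 2).
  assert (Hq : 0 < sqrt (INR n)) by (apply sqrt_lt_R0; lra).
  assert (Hqq : sqrt (INR n) * sqrt (INR n) = INR n) by (apply sqrt_sqrt; lra).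
  set (q := sqrt (INR n)) in *. set (M := INR m) in *.
  assert (HMq : 0 < M * q) by (apply Rmult_lt_0_compat; lra).
  set (w := y / (M * q)).
  assert (Hw : 1 <= w).
  { apply (Rmult_le_reg_r (M * q)); [lra|]. unfold w, Rdiv.
    rewrite Rmult_assoc, Rinv_l by lra. lra. }
  assert (Ey : y = M * q * w) by (unfold w; field; lra).
  assert (Hqm : q <= exp (M / 4)).
  { rewrite <- (sqrt_Rsqr (exp (M / 4))) by (left; apply exp_pos).
    apply sqrt_le_1_alt. unfold Rsqr. rewrite <- exp_plus.
    apply Rle_trans with (INR n + 1); [lra|].
    rewrite <- (exp_ln (INR n + 1)) by lra. apply exp_le. lra. }
  assert (Hwm : w <= exp (w - 1)) by (pose proof (exp_ineq1_le (w - 1)); lra).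
  assert (Hyle : y ^ m <= M ^ m * exp (M * (M / 4 + (w - 1)))).
  { unfold M at 2. rewrite <- exp_pow, <- Rpow_mult_distr. fold M.
    apply pow_incr. split; [lra|]. rewrite Ey, exp_plus, Rmult_assoc.
    apply Rmult_le_compat_l; [lra|]. apply Rmult_le_compat; lra. }
  assert (Hexp : exp (M * (M / 4 + (w - 1))) * exp (- (y ^ 2 / (4 * INR n))) <= 1).
  { rewrite <- exp_plus. eapply Rle_trans; [|right; apply exp_0]. apply exp_le.
    replace (y ^ 2 / (4 * INR n)) with (M ^ 2 * w ^ 2 / 4)
      by (rewrite Ey, <- Hqq; field; lra).
    (* Four times the gap between the exponents [M ^ 2 w ^ 2 / 4] and [M (M / 4 + w - 1)], factored;
       the last factor is nonnegative because [M >= 2] and [w >= 1]. *)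
    assert (0 <= (w - 1) * (M * (M * (w + 1) - 4)));
      [|lra].
    apply Rmult_le_pos; [lra|]. apply Rmult_le_pos; nra. }
  assert (HMM : M ^ m <= 3 ^ m * INR (fact m)).
  { eapply Rle_trans; [apply pow_le_fact_exp; lra|].
    rewrite (Rmult_comm (3 ^ m)). apply Rmult_le_compat_l; [apply pos_INR|].
    replace (exp M) with (exp 1 ^ m) by (rewrite exp_pow; f_equal; fold M; ring).
    apply pow_incr. split; [left; apply exp_pos | apply exp_le_3]. }
  apply Rle_trans with (M ^ m * exp (M * (M / 4 + (w - 1)))
                        * exp (- (y ^ 2 / (4 * INR n)))).
  { apply Rmult_le_compat_r; [left; apply exp_pos | exact Hyle]. }
  rewrite Rmult_assoc. assert (0 < M ^ m) by (apply pow_lt; lra).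
  eapply Rle_trans; [|exact HMM]. nra.
Qed.

Lemma pow_exp_quarter_le (y : R) (k : nat) :
  0 <= y -> y ^ k * exp (- (y / 4)) <= 4 ^ k * INR (fact k).
Proof.
  intros Hy. rewrite exp_Ropp. pose proof (exp_pos (y / 4)).
  apply (Rmult_le_reg_r (exp (y / 4))); [easy|].
  rewrite Rmult_assoc, Rinv_l, Rmult_1_r by lra.
  replace (y ^ k) with (4 ^ k * (y / 4) ^ k)
    by (rewrite <- Rpow_mult_distr; f_equal; field).
  rewrite Rmult_assoc. apply Rmult_le_compat_l; [apply pow_le; lra|].
  apply pow_le_fact_exp; lra.
Qed.

(* For [y = t - n <= n] the decay is Gaussian, for [y >= n] it is exponential. *)
Lemma large_argument_far (n m l : nat) (t : R) :
  (2 <= n)%nat -> 2 * ln (INR n + 1) <= INR m -> l = 0%nat \/ l = 1%nat ->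
  INR n + INR m * (sqrt (INR n) + 2) <= t ->
  Rabs (t ^ (m + l) * Derive_n (g n) m t)
    <= 4 * 8 ^ m * INR (fact (m + 2)) * (INR n + 1) ^ l.
Proof.
  intros Hn Hln Hl Ht.
  assert (HN : 2 <= INR n) by now apply (le_INR 2).
  assert (HM : (2 <= m)%nat).
  (* Since [n + 1 >= 3 >= exp 1], the logarithm is at least 1. *)
  { apply INR_le. simpl. apply Rle_trans with (2 * ln (INR n + 1)); [|exact Hln].
    assert (ln (exp 1) <= ln (INR n + 1)).
    { apply ln_le; [apply exp_pos|]. pose proof exp_le_3. lra. }
    rewrite ln_exp in H. lra. }
  pose proof (sqrt_pos (INR n)) as Hq.
  pose proof (le_INR _ _ HM) as HMR. simpl in HMR.
  set (y := t - INR n).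
  assert (Hy : INR m * sqrt (INR n) <= y) by (unfold y; nra).
  assert (Hy0 : 0 < y) by (unfold y; nra).
  assert (Ht0 : 0 < t) by (unfold y in Hy0; lra).
  assert (HG := g_nonneg n t (Rlt_le _ _ Ht0)).
  assert (HG0 : 0 <= t ^ 0 * Derive_n (g n) 0 t) by (simpl; lra).
  pose proof (scaled_recurrence_right (INR n) t
                (fun k => t ^ k * Derive_n (g n) k t) m
                HG0 ltac:(lra) Ht (scaled_recurrence_g n t)) as H.
  cbv beta in H. simpl (t ^ 0) in H.
  simpl (Derive_n (g n) 0 t) in H. rewrite Rmult_1_l in H. fold y in H.
  set (F := t ^ m * Derive_n (g n) m t) in *.
  replace (t ^ (m + l) * Derive_n (g n) m t) with (t ^ l * F)
    by (unfold F; rewrite pow_add; ring).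
  rewrite Rabs_mult, (Rabs_pos_eq (t ^ l)) by (apply pow_le; lra).
  assert (Hg : g n t <= exp (- (y ^ 2 / (2 * t)))).
  { eapply Rle_trans; [apply g_le_peak_right; unfold y in *; lra|]. fold y.
    rewrite <- (Rmult_1_l (exp _)) at 2.
    apply Rmult_le_compat_r; [left; apply exp_pos|].
    eapply Rle_trans; [apply g_peak_le|].
    rewrite <- Rinv_1. apply Rinv_le_contravar; [lra|].
    rewrite <- sqrt_1 at 1. apply sqrt_le_1_alt; lra. }
  assert (Htl : 0 < t ^ l) by (apply pow_lt; lra).
  assert (HNl : 1 <= (INR n + 1) ^ l) by (apply pow_R1_Rle; lra).
  pose proof (INR_fact_lt_0 (m + 2)) as Hf2.
  pose proof (INR_fact_lt_0 m) as Hf0.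
  assert (H2m : 0 < 2 ^ m) by (apply pow_lt; lra).
  assert (H8 : 8 ^ m = 2 ^ m * 4 ^ m)
    by (rewrite <- Rpow_mult_distr; f_equal; ring).
  assert (H34 : 3 ^ m <= 4 ^ m) by (apply pow_incr; lra).
  assert (H4m : 0 < 4 ^ m) by (apply pow_lt; lra).
  assert (Hym : 0 < y ^ m) by now apply pow_lt.
  rewrite Rpow_mult_distr in H.
  destruct (Rle_or_lt y (INR n)) as [Hyn | Hyn].
  - assert (HgG : g n t <= exp (- (y ^ 2 / (4 * INR n)))).
    { eapply Rle_trans; [exact Hg|]. apply exp_le, Ropp_le_contravar.
      apply Rmult_le_compat_l; [apply pow2_ge_0|].
      apply Rinv_le_contravar; unfold y in *; lra. }
    pose proof (pow_gaussian_le n m y ltac:(lia) HM Hln Hy) as HP.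
    set (e := exp (- (y ^ 2 / (4 * INR n)))) in *.
    assert (HF : Rabs F <= 8 ^ m * INR (fact (m + 2))).
    { eapply Rle_trans; [exact H|]. rewrite H8, !Rmult_assoc.
      apply Rmult_le_compat_l; [lra|].
      apply Rle_trans with (y ^ m * e); [apply Rmult_le_compat_l; lra|].
      eapply Rle_trans; [exact HP|].
      apply Rmult_le_compat; try lra; [apply pow_le; lra|].
      apply INR_fact_le; lia. }
    assert (Htl2 : t ^ l <= 2 * (INR n + 1) ^ l).
    { destruct Hl as [-> | ->]; simpl; unfold y in *; lra. }
    apply Rle_trans with (2 * (INR n + 1) ^ l * (8 ^ m * INR (fact (m + 2)))).
    + apply Rmult_le_compat; try lra. apply Rabs_pos.
    + assert (0 <= (INR n + 1) ^ l * (8 ^ m * INR (fact (m + 2)))).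
      { repeat apply Rmult_le_pos; try lra. rewrite H8; nra. }
      lra.
  - assert (HgE : g n t <= exp (- (y / 4))).
    { eapply Rle_trans; [exact Hg|]. apply exp_le, Ropp_le_contravar.
      replace (y / 4) with (y ^ 2 * / (4 * y)) by (field; lra).
      apply Rmult_le_compat_l; [apply pow2_ge_0|].
      apply Rinv_le_contravar; unfold y in *; lra. }
    pose proof (pow_exp_quarter_le y (m + l) (Rlt_le _ _ Hy0)) as HP.
    set (e := exp (- (y / 4))) in *.
    assert (Htl2 : t ^ l <= 2 ^ l * y ^ l).
    { rewrite <- Rpow_mult_distr. apply pow_incr. unfold y in *; lra. }
    (* Here [t < 2 y], so [t ^ l] joins [y ^ m] and costs an extra [8 ^ l]. For [l = 1] the factor
       [m + 2 >= 2] in [(m + 2)!] pays for it. *)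
    assert (HFl : 8 ^ l * INR (fact (m + l)) <= 4 * INR (fact (m + 2))).
    { pose proof (pos_INR m).
      assert (E1 : INR (fact (m + 1)) = (INR m + 1) * INR (fact m)).
      { replace (m + 1)%nat with (S m) by lia.
        rewrite fact_simpl, mult_INR, S_INR. ring. }
      assert (E2 : INR (fact (m + 2)) = (INR m + 2) * INR (fact (m + 1))).
      { replace (m + 2)%nat with (S (m + 1)) by lia.
        rewrite fact_simpl, mult_INR, S_INR, plus_INR. simpl; ring. }
      pose proof (INR_fact_lt_0 (m + 1)).
      destruct Hl as [-> | ->].
      - rewrite Nat.add_0_r. pose proof (INR_fact_le m (m + 2) ltac:(lia)).
        simpl; lra.
      - simpl pow. rewrite E2. nra. }
    apply Rle_trans with (2 ^ l * y ^ l * (2 ^ m * y ^ m * e)).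
    { apply Rmult_le_compat; try lra; [apply Rabs_pos|].
      eapply Rle_trans; [exact H|]. apply Rmult_le_compat_l; [|exact HgE].
      apply Rmult_le_pos; lra. }
    assert (H2l : 0 < 2 ^ l) by (apply pow_lt; lra).
    replace (2 ^ l * y ^ l * (2 ^ m * y ^ m * e))
      with (2 ^ l * 2 ^ m * (y ^ (m + l) * e)) by (rewrite pow_add; ring).
    apply Rle_trans with (2 ^ l * 2 ^ m * (4 ^ (m + l) * INR (fact (m + l)))).
    { apply Rmult_le_compat_l; [|exact HP]. apply Rmult_le_pos; lra. }
    replace (2 ^ l * 2 ^ m * (4 ^ (m + l) * INR (fact (m + l))))
      with (8 ^ m * (8 ^ l * INR (fact (m + l)))).
    + apply Rle_trans with (8 ^ m * (4 * INR (fact (m + 2)))).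
      { apply Rmult_le_compat_l; [|exact HFl]. rewrite H8; nra. }
      assert (0 <= 8 ^ m * (4 * INR (fact (m + 2)))).
      { rewrite H8. repeat apply Rmult_le_pos; lra. }
      nra.
    + rewrite H8. replace (8 ^ l) with (2 ^ l * 4 ^ l)
        by (rewrite <- Rpow_mult_distr; f_equal; ring).
      rewrite pow_add. ring.
Qed.

Lemma large_argument_estimate (n m l : nat) (t : R) :
  2 * ln (INR n + 1) <= INR m -> l = 0%nat \/ l = 1%nat ->
  large_threshold n m <= t ->
  Rabs (t ^ (m + l) * Derive_n (g n) m t)
    <= 4 * 8 ^ m * INR (fact (m + 2)) * (INR n + 1) ^ l.
Proof.
  intros Hln Hl Ht.
  destruct (Nat.le_gt_cases 2 n) as [Hn | Hn].
  - apply large_argument_far; try assumption.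
    destruct n as [|[|n]]; [lia | lia | exact Ht].
  - assert (Ht0 : 0 <= t) by (destruct n as [|[|n]]; [exact Ht | exact Ht | lia]).
    (* For [n <= 1] one has [4 sqrt (n + 1) <= 8], so the bound valid for every [t >= 0] already
       grows only like [8 ^ m]. *)
    eapply Rle_trans; [now apply scaled_derivative_le|].
    assert (HN : 0 <= INR n <= 1).
    { split; [apply pos_INR|]. apply (le_INR n 1). lia. }
    set (s := sqrt (INR n + 1)).
    assert (Hs1 : 1 <= s) by (unfold s; rewrite <- sqrt_1 at 1; apply sqrt_le_1_alt; lra).
    assert (Hs2 : s <= 2).
    { unfold s. rewrite <- (sqrt_Rsqr 2) by lra. apply sqrt_le_1_alt.
      unfold Rsqr; lra. }
    assert (HNl : 1 <= (INR n + 1) ^ l) by (apply pow_R1_Rle; lra).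
    assert (Hi : 0 < / s <= 1).
    { split; [apply Rinv_0_lt_compat; lra|]. rewrite <- Rinv_1.
      apply Rinv_le_contravar; lra. }
    apply Rle_trans with (INR (fact (m + 2)) * 8 ^ m * (4 * (INR n + 1) ^ l * 1)).
    + apply Rmult_le_compat.
      * apply Rmult_le_pos; [apply pos_INR | apply pow_le; lra].
      * apply Rmult_le_pos; lra.
      * apply Rmult_le_compat; [apply pos_INR | apply pow_le; lra
          | apply INR_fact_le; lia | apply pow_incr; lra].
      * apply Rmult_le_compat_l; lra.
    + right; ring.
Qed.

(** The 8 is [2 * 4]: 2 from the recurrence to the right of the peak, 4 from absorbing [y ^ m]. The
    bound follows from [10 / 9 = 1 + 1 / 9 <= exp (1 / 9)]. *)
Lemma eight_le_ratio : 8 <= 3 / ln (1 / (9 / 10)).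
Proof.
  assert (H0 : 0 < ln (1 / (9 / 10))) by (rewrite <- ln_1; apply ln_increasing; lra).
  assert (H : ln (1 / (9 / 10)) <= 1 / 9).
  { rewrite <- (ln_exp (1 / 9)). apply ln_le; [lra|].
    pose proof (exp_ineq1_le (1 / 9)). lra. }
  apply (Rmult_le_reg_r (ln (1 / (9 / 10)))); [exact H0|].
  set (x := ln (1 / (9 / 10))) in *.
  replace (3 / x * x) with 3 by (field; lra). lra.
Qed.

Theorem proposition2 :
  (forall (n m l : nat) (t : R),
     l = 0%nat \/ l = 1%nat -> 0 <= t ->
     Rabs (t ^ (m + l) * Derive_n (g n) m t)
       <= C_ m * Rpower (INR n + 1) ((INR m - 1) / 2 + INR l))
  /\
  (forall (n m : nat) (t : R),
     0 <= t <= INR n - INR m * sqrt (INR n) ->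
     Rabs (t ^ m * Derive_n (g n) m t)
       <= 2 ^ (m + 1) * (INR (fact (m + 2)) / sqrt (INR n + 1))
          * (INR n / (INR n - t)) ^ m)
  /\
  (let c := 9 / 10 in
   forall n m l : nat,
     INR m >= 2 * ln (INR n + 1) -> l = 0%nat \/ l = 1%nat ->
     forall t : R, t >= large_threshold n m ->
     Rabs (t ^ (m + l) * Derive_n (g n) m t)
       <= 4 * (3 / ln (1 / c)) ^ m * INR (fact (m + 2)) * (INR n + 1) ^ l)
  /\
  (forall (n : nat) (t : R),
     t >= INR n + sqrt (INR n) ->
     g n t <= 1 / sqrt (INR n + 1)
              * exp (sqrt (INR n) - t / (1 + sqrt (INR n)))).
Proof.
  split; [exact general_estimate|].
  split; [exact small_argument_estimate|].
  split.
  - intros c n m l Hm Hl t Ht. unfold c.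
    eapply Rle_trans; [apply large_argument_estimate; [lra | exact Hl | lra]|].
    pose proof eight_le_ratio as H8. pose proof (pos_INR n).
    apply Rmult_le_compat_r; [apply pow_le; lra|].
    apply Rmult_le_compat_r; [apply pos_INR|].
    apply Rmult_le_compat_l; [lra|]. apply pow_incr; lra.
  - intros n t Ht. rewrite Rdiv_1_l. apply g_le_exp_decay.
    pose proof (pos_INR n). pose proof (sqrt_pos (INR n)). lra.
Qed.
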